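(* Let $(a_1,\ldots,a_{2m})$, $m\ge1$, be a sequence of positive integers and let $(c_1,\ldots,c_k)$ be the corresponding sequence of integers greater than $1$, both associated with the same oriented fan triangulation $\mathbb T$ of an $n$-gon. Then $$K_{2m}(a_1,\ldots,a_{2m})_{q}=E_k(c_1,\ldots,c_k)_q=\sum_{\pi\,:\,k+1\to1}q^{\mathrm{coar}(\pi)},$$ $$K_{2m-1}(a_2,\ldots,a_{2m})_{q}=E_{k-1}(c_2,\ldots,c_k)_q=\sum_{\pi\,:\,k+1\to0}q^{\mathrm{coar}(\pi)},$$ where the sums run over all oriented paths $\pi$ in $\mathbb T$ starting at vertex $k+1$ and ending at vertex $1$, respectively at vertex $0$.
   Context: $q$-integers: for a positive integer $a$, $[a]_q=1+q+\cdots+q^{a-1}$ and $[a]_{q^{-1}}=1+q^{-1}+\cdots+q^{-(a-1)}$. $q$-continuants: $K_{2m}(a_1,\ldots,a_{2m})_q=q^{a_2+a_4+\cdots+a_{2m}-1}\det A$, where $A$ is the $2m\times2m$ tridiagonal matrix with diagonal entries $A_{ii}=[a_i]_q$ for $i$ odd and $A_{ii}=[a_i]_{q^{-1}}$ for $i$ even, superdiagonal entries $A_{i,i+1}=q^{a_i}$ for $i$ odd and $A_{i,i+1}=q^{-a_i}$ for $i$ even, and subdiagonal entries $A_{i+1,i}=-1$. $K_{2m-1}(a_2,\ldots,a_{2m})_q=q^{a_2+a_4+\cdots+a_{2m}-1}\det A'$, where $A'$ is $A$ with its first row and first column removed (same prefactor). $E_k(c_1,\ldots,c_k)_q$ is the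 determinant of the $k\times k$ tridiagonal matrix with diagonal entries $[c_1]_q,\ldots,[c_k]_q$, superdiagonal entries $q^{c_1-1},\ldots,q^{c_{k-1}-1}$ (entry $(i,i+1)$ is $q^{c_i-1}$) and all subdiagonal entries equal to $1$; $E_0()_q=1$. Fan triangulation $\mathbb T$ with parameters $(a_1,\ldots,a_{2m})$: put $k=a_2+a_4+\cdots+a_{2m}$, $\ell=a_1+a_3+\cdots+a_{2m-1}$, $n=k+\ell+2$. It is a triangulated $n$-gon (drawn in a horizontal strip) with top vertices, from left to right, $1,2,\ldots,k+1$ and bottom vertices, from left to right, $0,n-1,n-2,\ldots,k+2$. From left to right, starting at the edge $\{0,1\}$ and ending at the edge $\{k+1,k+2\}$, it consists of $a_1$ adjacent triangles ''base down'' (two consecutive bottom vertices and one top vertex), then $a_2$ adjacent triangles ''base up'' (two consecutive top vertices and one bottom vertex), then $a_3$ base down, $a_4$ base up, and so on. The integer $c_i$ ($1\le i\le k$) is the number of triangles incident to vertex $i$; explicitly $$(c_1,\ldots,c_k)=(a_1+1,\underbrace{2,\ldots,2}_{a_2-1},a_3+2,\underbrace{2,\ldots,2}_{a_4-1},\ldots,a_{2m-1}+2,\underbrace{2,\ldots,2}_{a_{2m}-1}),$$ and each sequence of integers $c_i\ge2$ arises from a unique $(a_1,\ldots,a_{2m})$. Orientation of $\mathbb T$: every edge joining two consecutive top vertices or two consecutive bottom vertices is oriented leftward. Every edge joining a top and a bottom vertex, other than $\{0,1\}$, is oriented upward (bottom to top) if the triangle immediately to its left is base down, and downward (top to bottom)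 if the triangle immediately to its left is base up; in particular $\{k+1,k+2\}$ is oriented $k+1\to k+2$. The edge $\{0,1\}$ has no orientation. A path in $\mathbb T$ is a sequence of consecutive oriented edges; it cannot use $\{0,1\}$. Coarea: the bottom path is $\beta:k+1\to k+2\to k+3\to\cdots\to n-1\to1$. For a path $\pi$ from $k+1$ to $1$ or $0$, $\mathrm{coar}(\pi)$ is the number of triangles enclosed between $\pi$ and $\beta$, i.e. the number of triangles with three oriented edges lying under $\pi$. The leftmost triangle $\{0,1,n-1\}$ is never counted. (A path ending at $0$ ends with the edge $n-1\to0$, and only its part up to $n-1$ encloses triangles with $\beta$.) *)

(* Defs.v *)
From HB Require Import structures.
From mathcomp Require Import all_boot all_order all_algebra.
From mathcomp Require Import zify.

Set Implicit Arguments.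
Unset Strict Implicit.
Unset Printing Implicit Defensive.

Import GRing.Theory.

(* A sequence (a_1, ..., a_2m) is given by m and a function a : nat -> nat, of
   which only the values a 1, ..., a m.*2 are used. *)

Definition ksum (m : nat) (a : nat -> nat) : nat :=
  \sum_(1 <= i < m.+1) a i.*2.

Definition lsum (m : nat) (a : nat -> nat) : nat :=
  \sum_(1 <= i < m.+1) a i.*2.-1.

Section Continuants.

Local Open Scope ring_scope.

Definition qint (R : comUnitRingType) (q : R) (a : nat) : R :=
  \sum_(0 <= i < a) q ^+ i.

(* The entry (i, j) of the matrix A, with rows and columns numbered from 1. *)
Definition contK_entry (R : comUnitRingType) (q : R) (a : nat -> nat)
    (i j : nat) : R :=
  if i == j then (if odd i then qint q (a i) else qint q^-1 (a i))
  else if j == i.+1 then (if odd i then q ^+ a i else q ^- a i)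
  else if i == j.+1 then - 1
  else 0.

(* K_2m(a_1, ..., a_2m)_q *)
Definition contK_even (R : comUnitRingType) (q : R) (m : nat)
    (a : nat -> nat) : R :=
  q ^+ (ksum m a).-1 *
  \det (\matrix_(i < m.*2, j < m.*2) contK_entry q a i.+1 j.+1).

(* K_2m-1(a_2, ..., a_2m)_q; a 1 is not used *)
Definition contK_odd (R : comUnitRingType) (q : R) (m : nat)
    (a : nat -> nat) : R :=
  q ^+ (ksum m a).-1 *
  \det (\matrix_(i < m.*2.-1, j < m.*2.-1) contK_entry q a i.+2 j.+2).

Definition contE (R : comUnitRingType) (q : R) (c : seq nat) : R :=
  \det (\matrix_(i < size c, j < size c)
    if i == j :> nat then qint q (nth 0%N c i)
    else if j == i.+1 :> nat then q ^+ (nth 0%N c i).-1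
    else if i == j.+1 :> nat then 1
    else 0).

End Continuants.

(* The triangles from left to right, true for base up, false for base down. *)
Definition fan_word (m : nat) (a : nat -> nat) : seq bool :=
  flatten [seq nseq (a i) (~~ odd i) | i <- iota 1 m.*2].

(* The vertices are labelled by natural numbers smaller than fan_n. *)
Definition fan_n (m : nat) (a : nat -> nat) : nat := (ksum m a + lsum m a).+2.

(* There are n - 2 = k + l triangles, numbered 0, ..., k + l - 1 from left to
   right. *)
Definition fan_ntri (m : nat) (a : nat -> nat) : nat := ksum m a + lsum m a.

Definition base_up (m : nat) (a : nat -> nat) (t : nat) : bool :=
  nth false (fan_word m a) t.

(* Labels of the top vertices 1, ..., k+1 and of the bottom vertices
   0, n-1, ..., k+2, by position from the left, starting from position 0. *)
Definition top (u : nat) : nat := u.+1.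
Definition bot (m : nat) (a : nat -> nat) (d : nat) : nat :=
  if d is 0 then 0 else fan_n m a - d.

(* Numbers of base up and of base down triangles among the first t ones: the
   positions of the top and of the bottom end of the t-th transversal edge,
   which has exactly t triangles on its left (the 0-th one is {0, 1}). *)
Definition ups (m : nat) (a : nat -> nat) (t : nat) : nat :=
  count id (take t (fan_word m a)).
Definition downs (m : nat) (a : nat -> nat) (t : nat) : nat :=
  count negb (take t (fan_word m a)).

Definition triangle (m : nat) (a : nat -> nat) (t : nat) : seq nat :=
  let u := ups m a t in let d := downs m a t in
  if base_up m a t then [:: top u; top u.+1; bot m a d]
  else [:: top u; bot m a d; bot m a d.+1].

(* (c_1, ..., c_k): numbers of triangles incident to the vertices 1, ..., k *)
Definition fan_c (m : nat) (a : nat -> nat) : seq nat :=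
  [seq count (fun t => i \in triangle m a t) (iota 0 (fan_ntri m a))
  | i <- iota 1 (ksum m a)].

(* The oriented transversal edge whose left neighbour is triangle t, as a pair
   (source, target). *)
Definition diag (m : nat) (a : nat -> nat) (t : nat) : nat * nat :=
  let u := top (ups m a t.+1) in let d := bot m a (downs m a t.+1) in
  if base_up m a t then (u, d) else (d, u).

Definition fan_edges (m : nat) (a : nat -> nat) : seq (nat * nat) :=
  [seq (top u.+1, top u) | u <- iota 0 (ksum m a)] ++
  [seq (bot m a d.+1, bot m a d) | d <- iota 0 (lsum m a)] ++
  [seq diag m a t | t <- iota 0 (fan_ntri m a)].

Definition arrow (m : nat) (a : nat -> nat) : rel nat :=
  fun x y => (x, y) \in fan_edges m a.

(* x :: p is the sequence of vertices of an oriented path from x to y. *)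
Definition fan_path (m : nat) (a : nat -> nat) (x y : nat) (p : seq nat) :
  bool := path (arrow m a) x p && (last x p == y).

(* The path beta from k+1 to 1, without its origin *)
Definition bottom_path (m : nat) (a : nat -> nat) : seq nat :=
  rcons (iota (ksum m a).+2 (lsum m a)) 1.

(* Number of transversal edges used by the path x :: p to the right of
   triangle t *)
Definition crossings (m : nat) (a : nat -> nat) (x : nat) (p : seq nat)
    (t : nat) : nat :=
  count (fun s => diag m a s \in zip (x :: p) p)
    (iota t (fan_ntri m a - t)).

(* Triangle t is enclosed between the path k+1 :: p and beta when the ray going
   from t to the right along the strip, which leaves the polygon through
   {k+1, k+2}, meets the closed curve made of these two paths an odd number of
   times. *)
Definition enclosed (m : nat) (a : nat -> nat) (p : seq nat) (t : nat) : bool :=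
  odd (crossings m a (ksum m a).+1 p t +
       crossings m a (ksum m a).+1 (bottom_path m a) t).

(* Triangle 0, which is {0, 1, n-1}, is left out. *)
Definition coar (m : nat) (a : nat -> nat) (p : seq nat) : nat :=
  count (enclosed m a p) (iota 1 (fan_ntri m a).-1).

Lemma count_fan_word (m : nat) (a : nat -> nat) :
  count id (fan_word m a) = ksum m a /\ count negb (fan_word m a) = lsum m a.
Proof.
rewrite /fan_word /ksum /lsum; elim: m => [|m [IHk IHl]].
  by rewrite !big_nil.
rewrite doubleS -addn2 iotaD map_cat flatten_cat !count_cat IHk IHl /=.
rewrite !(big_nat_recr m.+1) //= add1n /= odd_double /=.
rewrite ?count_cat !count_nseq /= ?doubleS /=; split; lia.
Qed.

Lemma size_fan_word (m : nat) (a : nat -> nat) :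
  size (fan_word m a) = fan_ntri m a.
Proof.
have [Ek El] := count_fan_word m a.
by rewrite /fan_ntri -Ek -El -(count_predC id).
Qed.

Lemma upsS (m : nat) (a : nat -> nat) (t : nat) :
  t < fan_ntri m a -> ups m a t.+1 = ups m a t + base_up m a t.
Proof.
rewrite -size_fan_word => lt_t.
by rewrite /ups (take_nth false) // -cats1 count_cat /= addn0.
Qed.

Lemma downsS (m : nat) (a : nat -> nat) (t : nat) :
  t < fan_ntri m a -> downs m a t.+1 = downs m a t + ~~ base_up m a t.
Proof.
rewrite -size_fan_word => lt_t.
by rewrite /downs (take_nth false) // -cats1 count_cat /= addn0.
Qed.

(* Number of t < N with f t < v: for a slowly increasing f, the least t such
   that f t = v. *)
Definition slow_rank (f : nat -> nat) (N v : nat) : nat :=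
  count (fun t => f t < v) (iota 0 N).

Lemma slow_rank_le (f : nat -> nat) (N v t : nat) :
    (forall s, s < N -> f s <= f s.+1) -> t <= N -> v <= f t ->
  slow_rank f N v <= t.
Proof.
move=> f_incr le_tN le_v.
have mono s : t <= s -> s <= N -> f t <= f s.
  elim: s => [|s IHs]; first by rewrite leqn0 => /eqP->.
  rewrite leq_eqVlt => /orP[/eqP-> //|lt_ts lt_sN].
  exact: leq_trans (IHs lt_ts (ltnW lt_sN)) (f_incr s lt_sN).
rewrite /slow_rank -(subnKC le_tN) iotaD count_cat.
rewrite [X in _ + X](_ : _ = 0) ?addn0.
  by rewrite -[X in _ <= X](size_iota 0) count_size.
apply/eqP; rewrite eqn0Ngt -has_count; apply/hasPn => s.
rewrite mem_iota -leqNgt => /andP[le_ts lt_s].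
apply: leq_trans le_v (mono s le_ts _); lia.
Qed.

Lemma slow_rank_gt (f : nat -> nat) (N v t : nat) :
    (forall s, s < N -> f s <= f s.+1) -> t < N -> f t < v ->
  t < slow_rank f N v.
Proof.
move=> f_incr lt_tN lt_v.
have mono s : s <= t -> f s <= f t.
  move=> le_st; rewrite -(subnK le_st).
  have: t - s + s < N by rewrite subnK.
  elim: (t - s) => [|j IHj] //; rewrite addSn => ltj.
  exact: leq_trans (IHj (ltnW ltj)) (f_incr _ (ltnW ltj)).
rewrite /slow_rank -(subnKC lt_tN) iotaD count_cat.
apply: leq_trans (leq_addr _ _).
rewrite (_ : count _ _ = t.+1) // -[RHS](size_iota 0) -count_predT.
apply: eq_in_count => s; rewrite mem_iota /= add0n ltnS => /mono le_f.
exact: leq_ltn_trans le_f lt_v.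
Qed.

Lemma slow_value (f : nat -> nat) (N v : nat) :
    f 0 = 0 -> (forall s, s < N -> f s.+1 <= (f s).+1) -> v <= f N ->
  exists2 t, t <= N & f t = v.
Proof.
move=> f0; elim: N => [|N IHN] slow.
  by rewrite f0 leqn0 => /eqP->; exists 0.
rewrite leq_eqVlt => /orP[/eqP->|lt_v]; first by exists N.+1.
have [|t le_t ft] := IHN (fun s lt_s => slow s (ltnW lt_s)).
  by have := slow N (leqnn _); lia.
by exists t => //; apply: leqW.
Qed.

Lemma slow_rank_step (f : nat -> nat) (N v : nat) :
    f 0 = 0 -> (forall s, s < N -> f s <= f s.+1) ->
    (forall s, s < N -> f s.+1 <= (f s).+1) -> v < f N ->
  slow_rank f N v < slow_rank f N v.+1.
Proof.
move=> f0 f_incr f_slow lt_v.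
have [t le_tN ft] := slow_value f0 f_slow (ltnW lt_v).
have lt_tN : t < N.
  by rewrite ltn_neqAle le_tN andbT; apply: contraTneq lt_v => <-; rewrite ft ltnn.
apply: (@leq_ltn_trans t); first by apply: slow_rank_le; rewrite ?ft.
by apply: slow_rank_gt; rewrite ?ft.
Qed.

(* Number of triangles to the left of the leftmost transversal edge at v *)
Definition fan_rank (m : nat) (a : nat -> nat) (v : nat) : nat :=
  if 0 < v <= (ksum m a).+1 then slow_rank (ups m a) (fan_ntri m a) v.-1
  else slow_rank (downs m a) (fan_ntri m a)
    (if v == 0 then 0 else fan_n m a - v).

Lemma ups_le (m : nat) (a : nat -> nat) (t : nat) : ups m a t <= ksum m a.
Proof.
have [<- _] := count_fan_word m a.
by rewrite /ups -{2}(cat_take_drop t (fan_word m a)) count_cat leq_addr.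
Qed.

Lemma downs_le (m : nat) (a : nat -> nat) (t : nat) : downs m a t <= lsum m a.
Proof.
have [_ <-] := count_fan_word m a.
by rewrite /downs -{2}(cat_take_drop t (fan_word m a)) count_cat leq_addr.
Qed.

Lemma fan_rank_top (m : nat) (a : nat -> nat) (u : nat) :
  u <= ksum m a -> fan_rank m a (top u) = slow_rank (ups m a) (fan_ntri m a) u.
Proof. by rewrite /fan_rank /top /= ltnS => ->. Qed.

Lemma fan_rank_bot (m : nat) (a : nat -> nat) (d : nat) :
    d <= lsum m a ->
  fan_rank m a (bot m a d) = slow_rank (downs m a) (fan_ntri m a) d.
Proof.
move=> le_d; rewrite /fan_rank /bot; case: d le_d => [|d] le_d //=.
rewrite ifF; last by rewrite /fan_n; lia.
by rewrite ifF; [rewrite subKn | ]; rewrite /fan_n; lia.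
Qed.

Lemma arrow_rank (m : nat) (a : nat -> nat) (x y : nat) :
    arrow m a x y ->
  [/\ y < fan_n m a, fan_rank m a y < fan_rank m a x
    & fan_rank m a x <= fan_ntri m a].
Proof.
set N := fan_ntri m a.
have ltbot d : bot m a d < fan_n m a.
  by rewrite /bot /fan_n; case: d => [|d] //; lia.
have lttop u : u <= ksum m a -> top u < fan_n m a by rewrite /top /fan_n; lia.
have rank_leN v : fan_rank m a v <= N.
  by rewrite /fan_rank; case: ifP => _;
     rewrite -[X in _ <= X](size_iota 0) count_size.
suff: arrow m a x y -> y < fan_n m a /\ fan_rank m a y < fan_rank m a x.
  by move=> sub /sub[].
have ups0 : ups m a 0 = 0 by rewrite /ups take0.
have downs0 : downs m a 0 = 0 by rewrite /downs take0.
have upsN : ups m a N = ksum m a.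
  by rewrite /ups /N -size_fan_word take_size; case: (count_fan_word m a).
have downsN : downs m a N = lsum m a.
  by rewrite /downs /N -size_fan_word take_size; case: (count_fan_word m a).
have ups_incr s : s < N -> ups m a s <= ups m a s.+1.
  by move=> /upsS->; rewrite leq_addr.
have downs_incr s : s < N -> downs m a s <= downs m a s.+1.
  by move=> /downsS->; rewrite leq_addr.
have ups_slow s : s < N -> ups m a s.+1 <= (ups m a s).+1.
  by move=> /upsS->; case: base_up; lia.
have downs_slow s : s < N -> downs m a s.+1 <= (downs m a s).+1.
  by move=> /downsS->; case: base_up; lia.
rewrite /arrow !mem_cat => /or3P[] /mapP[t]; rewrite mem_iota add0n => lt_t.
- case=> -> ->; rewrite !fan_rank_top ?(ltnW lt_t) //; split.
    exact/lttop/ltnW.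
  by apply: slow_rank_step; rewrite ?upsN.
- case=> -> ->; rewrite -/(bot m a t.+1) !fan_rank_bot ?(ltnW lt_t) //; split=> //.
  by apply: slow_rank_step; rewrite ?downsN.
- rewrite /diag; case up_t: base_up => -[-> ->]; split=> //.
  + rewrite fan_rank_top ?ups_le // fan_rank_bot ?downs_le //.
    apply: (@leq_ltn_trans t).
      by apply: slow_rank_le => //; rewrite ?(ltnW lt_t) // downsS // up_t addn0.
    by apply: slow_rank_gt => //; rewrite upsS // up_t addn1.
  + exact/lttop/ups_le.
  + rewrite fan_rank_top ?ups_le // fan_rank_bot ?downs_le //.
    apply: (@leq_ltn_trans t).
      by apply: slow_rank_le => //; rewrite ?(ltnW lt_t) // upsS // up_t addn0.
    by apply: slow_rank_gt => //; rewrite downsS // up_t addn1.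
Qed.

(* The orientation is acyclic and the oriented paths have less than n edges. *)
Lemma fan_path_bounded (m : nat) (a : nat -> nat) (x y : nat) (p : seq nat) :
    fan_path m a x y p ->
  size p < fan_n m a /\ all (fun v => v < fan_n m a) p.
Proof.
case/andP=> xp _.
suff [le_p lt_p] : size p <= fan_rank m a x /\ all (fun v => v < fan_n m a) p.
  split=> //; case: p xp le_p {lt_p} => [|z p] //= /andP[/arrow_rank[_ _ le_x] _].
  by move=> lt_p; rewrite /fan_n -/(fan_ntri m a); lia.
elim: p x xp => [|z p IHp] x //= /andP[/arrow_rank[lt_z lt_x _] /IHp[le_p ->]].
by rewrite lt_z; split=> //; apply: leq_ltn_trans le_p lt_x.
Qed.

(* Sum of q ^ coar over the oriented paths from k+1 to y.  By fan_path_bounded,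
   restricting the paths to at most n edges and to vertices smaller than n
   leaves none out. *)
Definition path_sum (R : comUnitRingType) (q : R) (m : nat) (a : nat -> nat)
    (y : nat) : R :=
  (\sum_(p : (fan_n m a).-bseq 'I_(fan_n m a)
         | fan_path m a (ksum m a).+1 y (map val p))
     q ^+ coar m a (map val p))%R.

(* Main.v *)
Require Import Defs.
From HB Require Import structures.
From mathcomp Require Import all_boot all_order all_algebra.
From mathcomp Require Import zify ring.

Set Implicit Arguments.
Unset Strict Implicit.
Unset Printing Implicit Defensive.

Import GRing.Theory.

(** Read the fan from left to right, one triangle at a time.  To each
    transversal edge attach the pair (T, F), where T and F sum q ^ area over the
    oriented paths going from its top, respectively bottom, end to the chosen
    target (1 or 0).  The three edges of a triangle are its transversal right
    and left sides and a horizontal one; both arrows that leave its apex (the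
    end of the right side which is not on the left side) point to the ends of
    the left side.  A path hence either stays at the end shared by the two sides
    or goes from the apex to one of the ends of the left side, and the triangle
    is enclosed exactly when the path is at the top afterwards.  So a base up
    triangle changes (T, F) into (q T + F, F), a base down one into
    (q T, F + q T); see [transfer] and [sum_fan_paths].  All three members of
    the proposition are the T component at the last transversal edge
    {k+1, k+2}:

    - Paths: [mem_fan_paths] lists the paths by this recursion, and
      [side_move], [side_stay] show that the parity of the crossings to the
      right of a triangle only records the side on which the path passes it.
      The leftmost triangle is not counted by the coarea, although all paths to
      1 pass above it: for the target 1 the recursion is therefore started from
      (q^-1, 0) instead of (1, 0) ([area_coar], [path_sum_transfer]).

    - E: let c_1, ..., c_u, c be the numbers of triangles met so far by the top
      vertices already encountered.  Then F = E(c_1, ..., c_u, c) and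
      q T = q^c E(c_1, ..., c_u), for both kinds of triangles
      ([contE_transfer]); with target 0 the same holds without c_1, once
      vertex 1 has been left ([contE_behead_transfer]).

    - K: the a_i-th power of a transfer step is explicit ([transfer_up],
      [transfer_down]), and up to powers of q, the values of F after the base
      down blocks and of q T after the base up ones are the successive leading
      minors of the matrix A ([contK_entry_transfer]). *)

(** * Tridiagonal determinants *)

Section Tridiagonal.
Local Open Scope ring_scope.
Variable R : comUnitRingType.

Definition lead_minor (f : nat -> nat -> R) (n : nat) : R :=
  \det (\matrix_(i < n, j < n) f i j).

Lemma lead_minor0 f : lead_minor f 0 = 1.
Proof. by rewrite /lead_minor det_mx00. Qed.

Lemma lead_minor1 f : lead_minor f 1 = f 0%N 0%N.
Proof. by rewrite /lead_minor det_mx11 mxE. Qed.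

(** Laplace expansion along the last row leaves two minors, and the one with the
    off-diagonal entry is expanded along its last column. *)
Lemma lead_minorSS f n :
    (forall j, (j < n)%N -> f n.+1 j = 0) ->
    (forall i, (i < n)%N -> f i n.+1 = 0) ->
  lead_minor f n.+2 =
    f n.+1 n.+1 * lead_minor f n.+1 - f n n.+1 * f n.+1 n * lead_minor f n.
Proof.
move=> row0 col0; rewrite /lead_minor (expand_det_row _ ord_max).
rewrite 2!big_ord_recr /= big1 ?add0r; last first.
  by move=> j _; rewrite mxE /= row0 ?mul0r //= ltn_ord.
rewrite !mxE /= addrC; congr (_ + _).
  rewrite /cofactor /= addnn -signr_odd odd_double expr0 mul1r.
  congr (_ * \det _); apply/matrixP=> i j.
  have lti := ltn_ord i; have ltj := ltn_ord j; rewrite !mxE /= /bump.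
  by congr (f _ _); lia.
rewrite /cofactor /= addSn addnn -signr_odd /= odd_double expr1 mulN1r mulrN.
congr (- _); rewrite (expand_det_col _ ord_max) big_ord_recr /= big1 ?add0r.
  rewrite !mxE /= {1}/bump leqNgt ltnS leqnn add0n {1}/bump leqnn add1n.
  rewrite /cofactor /= addnn -signr_odd odd_double expr0 mul1r.
  rewrite mulrCA mulrA; congr (_ * \det _); apply/matrixP=> i j.
  have lti := ltn_ord i; have ltj := ltn_ord j; rewrite !mxE /= /bump.
  by congr (f _ _); lia.
move=> i _; rewrite !mxE /= {1}/bump leqNgt ltnS (ltnW (ltn_ord i)) add0n.
by rewrite /bump leqnn add1n col0 ?mul0r.
Qed.

End Tridiagonal.

(** * The continuants E and the q-integers *)

Section Continuants.
Local Open Scope ring_scope.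
Variables (R : comUnitRingType) (q : R).

Lemma qint0 (x : R) : qint x 0 = 0.
Proof. by rewrite /qint big_nil. Qed.

Lemma qintS (x : R) n : qint x n.+1 = qint x n + x ^+ n.
Proof. by rewrite /qint big_nat_recr. Qed.

Lemma qintSl (x : R) n : qint x n.+1 = 1 + x * qint x n.
Proof.
rewrite /qint big_nat_recl // expr0 mulr_sumr; congr (_ + _).
by apply: eq_bigr => i _; rewrite exprS.
Qed.

Lemma qint_inv n : q \is a GRing.unit -> q ^+ n * qint q^-1 n = q * qint q n.
Proof.
move=> q_unit; elim: n => [|n IHn]; first by rewrite !qint0 !mulr0.
rewrite qintS qintSl !mulrDr mulr1 addrC exprVn exprS mulrK ?unitrX //.
by rewrite -mulrA IHn.
Qed.

Definition contE_entry (c : seq nat) (i j : nat) : R :=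
  if i == j then qint q (nth 0%N c i)
  else if j == i.+1 then q ^+ (nth 0%N c i).-1
  else if i == j.+1 then 1 else 0.

(** The entries beyond c are free, so the continuants of all prefixes of a
    sequence are leading minors of one matrix. *)
Lemma contE_minor c s : contE q c = lead_minor (contE_entry (c ++ s)) (size c).
Proof.
congr (\det _); apply/matrixP=> i j; rewrite !mxE /contE_entry.
by rewrite nth_cat ltn_ord.
Qed.

Lemma contE_nil : contE q [::] = 1.
Proof. by rewrite (contE_minor _ [::]) lead_minor0. Qed.

Lemma contE1 c : contE q [:: c] = qint q c.
Proof. by rewrite (contE_minor _ [::]) lead_minor1. Qed.

Lemma contE_rcons2 s c d :
  contE q (rcons (rcons s c) d) =
    qint q d * contE q (rcons s c) - q ^+ c.-1 * contE q s.
Proof.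
rewrite (contE_minor (rcons (rcons s c) d) [::]).
rewrite (contE_minor (rcons s c) [:: d]).
rewrite (contE_minor s [:: c; d]) cats0 !size_rcons cats1 -cat_rcons cats1.
rewrite lead_minorSS.
- congr (_ * _ - _ * _); rewrite /contE_entry.
    by rewrite eqxx nth_rcons size_rcons ltnn eqxx.
  rewrite (ltn_eqF (ltnSn _)) eqxx (gtn_eqF (ltnSn _)) ltn_eqF // mulr1.
  by rewrite !nth_rcons size_rcons ltnSn ltnn eqxx.
- move=> j ltj; rewrite /contE_entry !ifF //; lia.
- move=> i lti; rewrite /contE_entry !ifF //; lia.
Qed.

(** A triangle added at the last vertex only changes [c]_q into
    [c]_q + q ^ c. *)
Lemma contE_rconsS s c :
  contE q (rcons s c.+1) = contE q (rcons s c) + q ^+ c * contE q s.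
Proof.
case/lastP: s => [|s b]; first by rewrite /= !contE1 contE_nil qintS mulr1.
by rewrite !contE_rcons2 qintS mulrDl addrAC.
Qed.

(** Completing the last vertex with one triangle, which is the first one of the
    next vertex, preserves E; this is why F is left unchanged by a base up
    triangle. *)
Lemma contE_rcons_one s c :
  contE q (rcons (rcons s c.+1) 1) = contE q (rcons s c).
Proof.
rewrite contE_rcons2 /= /qint big_nat1 expr0 mul1r contE_rconsS.
by rewrite addrK.
Qed.

End Continuants.

(** * Transfer along a word of triangles *)

Lemma ksumS m a : ksum m.+1 a = ksum m a + a m.*2.+2.
Proof. by rewrite /ksum big_nat_recr. Qed.

Lemma fan_wordS m a :
  fan_word m.+1 a =
    fan_word m a ++ nseq (a m.*2.+1) false ++ nseq (a m.*2.+2) true.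
Proof.
rewrite /fan_word doubleS -[in LHS]addn2 iotaD map_cat flatten_cat /=.
by rewrite add1n /= odd_double /= cats0.
Qed.

Section Transfer.
Local Open Scope ring_scope.
Variables (R : comUnitRingType) (q : R).

(** Effect of one triangle, base up when b holds, on the weighted numbers of
    paths from the top and from the bottom end of a transversal edge. *)
Definition transfer (W : R * R) (b : bool) : R * R :=
  if b then (q * W.1 + W.2, W.2) else (q * W.1, W.2 + q * W.1).

Lemma transfer_up n W :
  foldl transfer W (nseq n true) = (q ^+ n * W.1 + qint q n * W.2, W.2).
Proof.
elim: n W => [|n IHn] [T F] /=; first by rewrite qint0; congr (_, _); ring.
by rewrite IHn /= qintS exprS; congr (_, _); ring.
Qed.

Lemma transfer_down n W :
  foldl transfer W (nseq n false) =
    (q ^+ n * W.1, W.2 + q * qint q n * W.1).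
Proof.
elim: n W => [|n IHn] [T F] /=; first by rewrite qint0; congr (_, _); ring.
by rewrite IHn /= qintSl exprS; congr (_, _); ring.
Qed.

(** In the result (s, c), s lists the numbers of triangles at the top vertices
    already left behind and c counts those seen so far at the current one.  A
    base up triangle is the last one at the current vertex and the first one at
    the next. *)
Definition fan_counts : seq bool -> seq nat * nat :=
  foldl (fun sc b => if b then (rcons sc.1 sc.2.+1, 1%N) else (sc.1, sc.2.+1))
    ([::], 0%N).

Lemma fan_counts_rcons w b :
  fan_counts (rcons w b) = let: (s, c) := fan_counts w in
    if b then (rcons s c.+1, 1%N) else (s, c.+1).
Proof. by rewrite /fan_counts foldl_rcons; case: (foldl _ _ _). Qed.

(** The invariant of the transfer steps which computes E. *)
Definition contE_state (s : seq nat) (c : nat) (W : R * R) : Prop :=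
  W.2 = contE q (rcons s c) /\ q * W.1 = q ^+ c * contE q s.

Lemma contE_state_down s c W :
  contE_state s c W -> contE_state s c.+1 (transfer W false).
Proof.
case: W => T F [/= EF ET]; split; rewrite /= ET ?EF ?contE_rconsS //.
by rewrite exprS mulrA.
Qed.

Lemma contE_state_up s c W :
  contE_state s c W -> contE_state (rcons s c.+1) 1 (transfer W true).
Proof.
case: W => T F [/= EF ET]; split; rewrite /= EF.
  by rewrite contE_rcons_one.
by rewrite ET contE_rconsS expr1 addrC.
Qed.

(** At the edge {0, 1} no triangle has been seen, and the initial pair (q^-1, 0)
    is the one for which the invariant reads E(0) = 0 and q T = 1. *)
Lemma contE_transfer w :
    q \is a GRing.unit -> let: (s, c) := fan_counts w in
  contE_state s c (foldl transfer (q^-1, 0) w).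
Proof.
move=> q_unit; elim/last_ind: w => [|w b].
  by split; rewrite /= ?contE1 ?qint0 // contE_nil expr0 mulr1 mulrV.
rewrite fan_counts_rcons foldl_rcons; case: fan_counts => s c IHw.
by case: b; [apply: contE_state_up | apply: contE_state_down].
Qed.

(** With target 0, no path leaves vertex 1 and the bottom edges give exactly one
    path, so that (0, 1) stays until the top vertex 2 is reached; the invariant
    without c_1 starts there. *)
Lemma contE_behead_transfer w :
    let: (s, c) := fan_counts w in let W := foldl transfer (0, 1) w in
  if s is _ :: s' then contE_state s' c W else W = (0, 1).
Proof.
elim/last_ind: w => [|w b] //; rewrite fan_counts_rcons foldl_rcons.
case: fan_counts => -[|c1 s] c /= IHw.
  rewrite IHw /transfer /=; case: b; rewrite /= !mulr0 ?addr0 // add0r.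
  by split; rewrite /= ?contE1 ?contE_nil ?mulr1 // /qint big_nat1.
by case: b; [apply: contE_state_up | apply: contE_state_down].
Qed.

(** The sequence d stands for the leading minors of A, shifted by one so that
    its first two values encode the initial pair (T, F).  As F is unchanged by the
    base up triangles, it lags by the power q ^ a_2m behind q T.  The recursion
    needs no lower bound on j: the entry (0, 1) of the extended matrix A, equal
    to q ^- a 0, is absorbed in the normalisation of d 0. *)
Lemma contK_entry_transfer m a (d : nat -> R) (W : R * R) :
    q \is a GRing.unit ->
    (forall j, d j.+2 = contK_entry q a j.+1 j.+1 * d j.+1
                        + contK_entry q a j j.+1 * d j) ->
    q * W.1 = d 1 -> W.2 = q ^- a 0 * d 0 ->
  let W' := foldl transfer W (fan_word m a) in
  q * W'.1 = q ^+ ksum m a * d m.*2.+1 /\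
  W'.2 = q ^+ ksum m a * q ^- a m.*2 * d m.*2.
Proof.
move=> q_unit d_rec W1 W2.
have odd_rec i : d i.*2.+2 = qint q (a i.*2.+1) * d i.*2.+1
                             + q ^- a i.*2 * d i.*2.
  by rewrite d_rec /contK_entry eqxx (ltn_eqF (ltnSn _)) /= odd_double.
have even_rec i : d i.*2.+3 = qint q^-1 (a i.*2.+2) * d i.*2.+2
                             + q ^+ a i.*2.+1 * d i.*2.+1.
  by rewrite d_rec /contK_entry eqxx (ltn_eqF (ltnSn _)) /= odd_double.
elim: m => [|m [IHT IHF]].
  by rewrite /ksum big_geq // expr0 !mul1r.
rewrite fan_wordS !foldl_cat.
move: (foldl _ _ _) IHT IHF => -[T F] /= IHT IHF.
rewrite transfer_down transfer_up doubleS ksumS /=.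
set K := ksum m a in IHT IHF *; set a2 := a _.+2; set a1 := a _.+1.
(* The a_{2m+1} base down triangles give the next odd minor. *)
have EF : F + q * qint q a1 * T = q ^+ K * d m.*2.+2.
  rewrite mulrAC IHT IHF odd_rec -/a1; ring.
rewrite EF exprD [q ^+ K * _ * _]mulrAC mulrK ?unitrX //; split=> //.
rewrite mulrDr even_rec -/a1 -/a2 mulrDr.
have ->: q * (q ^+ a2 * (q ^+ a1 * T)) = q ^+ a2 * q ^+ a1 * (q * T) by ring.
have ->: q * (qint q a2 * (q ^+ K * d m.*2.+2)) =
         (q * qint q a2) * (q ^+ K * d m.*2.+2) by ring.
rewrite -qint_inv // IHT; ring.
Qed.

Lemma contK_minor_rec a s i :
  let f i j := contK_entry q a (s + i) (s + j) in
  lead_minor f i.+2 =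
    f i.+1 i.+1 * lead_minor f i.+1 + f i i.+1 * lead_minor f i.
Proof.
move=> f; rewrite lead_minorSS.
- rewrite [f i.+1 i]/f /contK_entry ifF; last by lia.
  by rewrite ifF ?ifT ?mulrN1 ?mulNr ?opprK //; lia.
- by move=> j ltj; rewrite /f /contK_entry !ifF //; lia.
- by move=> j ltj; rewrite /f /contK_entry !ifF //; lia.
Qed.

Lemma unit_cancel_pow k (x y : R) :
  q \is a GRing.unit -> (0 < k)%N -> q * x = q ^+ k * y -> q ^+ k.-1 * y = x.
Proof.
move=> q_unit; case: k => // k _; rewrite exprS -mulrA.
by move/(mulrI q_unit).
Qed.

(** The minors 1, [a_1]_q, ... of A, preceded by 0, satisfy the recursion. *)
Lemma contK_even_transfer m a :
    q \is a GRing.unit -> (0 < ksum m a)%N ->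
  contK_even q m a = (foldl transfer (q^-1, 0) (fan_word m a)).1.
Proof.
move=> q_unit k_gt0; apply: unit_cancel_pow => //.
pose f i j := contK_entry q a i.+1 j.+1.
pose d j := if j is j'.+1 then lead_minor f j' else 0.
have [|||-> _] // := @contK_entry_transfer m a d (q^-1, 0) q_unit.
- case=> [|j]; last exact: (contK_minor_rec a 1).
  by rewrite /d /= mulr0 addr0 lead_minor0 lead_minor1 mulr1.
- by rewrite /d /= lead_minor0 /= mulrV.
- by rewrite mulr0.
Qed.

(** For A without its first row and column the minors are shifted by one more
    place: a minor 0 precedes 1, and the value before them is forced to be
    q ^ a 0 by the recursion. *)
Lemma contK_odd_transfer m a :
    q \is a GRing.unit -> (0 < ksum m a)%N -> (0 < m)%N ->
  contK_odd q m a = (foldl transfer (0, 1) (fan_word m a)).1.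
Proof.
move=> q_unit k_gt0 m_gt0; apply: unit_cancel_pow => //.
pose f i j := contK_entry q a i.+2 j.+2.
pose d j := if j is j'.+1 then if j' is j''.+1 then lead_minor f j'' else 0
            else q ^+ a 0.
have [|||-> _] // := @contK_entry_transfer m a d (0, 1) q_unit.
- case=> [|[|j]]; last exact: (contK_minor_rec a 2).
  + by rewrite /d /= mulr0 add0r lead_minor0 /contK_entry /= mulVr ?unitrX.
  + by rewrite /d /= lead_minor0 lead_minor1 mulr0 addr0 mulr1.
- by rewrite mulr0.
- by rewrite /d /= mulVr ?unitrX.
- by case: m m_gt0 {k_gt0}.
Qed.

End Transfer.

(** * Arrows and paths along the transversal edges *)

Section FanGeometry.
Variables (m : nat) (a : nat -> nat).
Let N := fan_ntri m a.

(** Top and bottom are treated alike: the boolean b selects the top side, as it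
    selects the base up triangles, whose horizontal side is at the top. *)
Definition pos (b : bool) (t : nat) : nat :=
  if b then ups m a t else downs m a t.
Definition label (b : bool) (p : nat) : nat := if b then top p else bot m a p.
Definition fan_end (b : bool) (t : nat) : nat := label b (pos b t).
(** The horizontal side of triangle t joins its apex to the end of the left
    transversal side which lies on the same side of the strip. *)
Definition apex (t : nat) : nat := fan_end (base_up m a t) t.+1.

Lemma pos0 b : pos b 0 = 0.
Proof. by case: b; rewrite /pos /ups /downs take0. Qed.

Lemma posS b t : t < N -> pos b t.+1 = pos b t + (base_up m a t == b).
Proof.
by move=> ltt; case: b; rewrite /pos ?upsS ?downsS // ?eqb_id ?eqbF_neg.
Qed.

Lemma posE b t : t <= N -> pos b t + pos (~~ b) t = t.
Proof.
move=> le_t; rewrite -[RHS](size_takel (s := fan_word m a)) ?size_fan_word //.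
by rewrite -(count_predC id); case: b; rewrite //= addnC.
Qed.

Lemma posN b : pos b N = if b then ksum m a else lsum m a.
Proof.
have [Ek El] := count_fan_word m a.
by case: b; rewrite /pos /ups /downs take_oversize ?size_fan_word.
Qed.

Lemma pos_mono b s t : s <= t -> t <= N -> pos b s <= pos b t.
Proof.
elim: t => [|t IHt]; first by rewrite leqn0 => /eqP->.
rewrite leq_eqVlt => /orP[/eqP-> //|lt_st] lt_tN.
rewrite posS //; apply: leq_trans (leq_addr _ _).
by apply: IHt => //; apply: ltnW.
Qed.

Lemma pos_leN b t : t <= N -> pos b t <= pos b N.
Proof. by move=> le_t; apply: pos_mono. Qed.

Lemma label_inj b b' p p' : p <= pos b N -> p' <= pos b' N ->
  label b p = label b' p' -> b = b' /\ p = p'.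
Proof.
rewrite !posN /label /top /bot /fan_n.
case: b; case: b' => /=; case: p => [|p]; case: p' => [|p'] //= lep lep' E;
  by split=> //; lia.
Qed.

(** Positions increase by at most one, so each horizontal edge is a side of some
    triangle. *)
Lemma pos_step b p t : t <= N -> p < pos b t ->
  exists2 s, s < t & base_up m a s = b /\ pos b s = p.
Proof.
elim: t => [|t IHt] le_tN; first by rewrite pos0.
have [/IHt IH _|le_p] := ltnP p (pos b t).
  by have [|s lt_s Hs] := IH; [exact: ltnW | exists s => //; exact: ltnW].
rewrite posS //; case: eqP => [Eb|_]; last by lia.
by exists t => //; split=> //; lia.
Qed.

Lemma fan_end_stay t : t < N ->
  fan_end (~~ base_up m a t) t.+1 = fan_end (~~ base_up m a t) t.
Proof.
by move=> ltt; rewrite /fan_end posS //; case: base_up; rewrite addn0.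
Qed.

Lemma pos_apex t : t < N ->
  pos (base_up m a t) t.+1 = (pos (base_up m a t) t).+1.
Proof. by move=> ltt; rewrite posS // eqxx addn1. Qed.

Lemma apexE t : t < N ->
  apex t = label (base_up m a t) (pos (base_up m a t) t).+1.
Proof. by move=> ltt; rewrite /apex /fan_end pos_apex. Qed.

Lemma diagE t : t < N -> diag m a t = (apex t, fan_end (~~ base_up m a t) t).
Proof.
move=> ltt; rewrite -fan_end_stay // /diag /apex /fan_end /label /pos.
by case: base_up.
Qed.

(** The apex of triangle s lies strictly to the right, on its side of the strip,
    of all transversal edges up to the left side of the triangle. *)
Lemma apex_neq s t b : s < N -> t <= s -> apex s <> fan_end b t.
Proof.
move=> lts le_ts; rewrite apexE // => /label_inj[].
- by rewrite -pos_apex // pos_leN.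
- by apply: pos_leN; lia.
- by move=> <-; have := pos_mono (base_up m a s) le_ts (ltnW lts); lia.
Qed.

(** Both arrows inside triangle t start at its apex: the horizontal one stays on
    its side, the transversal one crosses the strip. *)
Lemma arrowP x y : reflect
  (exists2 t, t < N & x = apex t /\ exists b, y = fan_end b t) (arrow m a x y).
Proof.
rewrite /arrow !mem_cat; apply: (iffP or3P).
- case=> /mapP[t]; rewrite mem_iota add0n => /= lt_t.
  + case=> -> ->; have [//||s lts [up_s pos_s]] := @pos_step true t N.
      by rewrite posN.
    exists s => //; rewrite apexE // up_s pos_s; split=> //.
    by exists true; rewrite /fan_end pos_s.
  + case=> -> ->; have [//||s lts [up_s pos_s]] := @pos_step false t N.
      by rewrite posN.
    exists s => //; rewrite apexE // up_s pos_s; split=> //.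
    by exists false; rewrite /fan_end pos_s.
  + by rewrite diagE // => -[-> ->]; exists t => //; split=> //; eexists.
- case=> t lt_t [-> [b ->]]; have [Eb|/eqP] := eqVneq b (base_up m a t).
    rewrite apexE // {b}Eb /fan_end.
    have := pos_leN (base_up m a t) lt_t; rewrite posS // eqxx addn1 posN.
    case: base_up => lt_p; [apply: Or31 | apply: Or32]; apply/mapP.
      by exists (pos true t); rewrite // mem_iota.
    by exists (pos false t); rewrite // mem_iota.
  move=> neb; apply: Or33; apply/mapP; exists t; first by rewrite mem_iota.
  by rewrite diagE //; congr (_, fan_end _ _); case: b base_up neb => [] [].
Qed.

Lemma apex_inj s t : s < N -> t < N -> apex s = apex t -> s = t.
Proof.
move=> lts ltt Est; case: (ltngtP s t) => // [lt_st|lt_ts].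
  by case: (@apex_neq t s.+1 (base_up m a s) ltt lt_st).
by case: (@apex_neq s t.+1 (base_up m a t) lts lt_ts).
Qed.

Lemma arrow_apex t y : t < N ->
  arrow m a (apex t) y = (y == fan_end true t) || (y == fan_end false t).
Proof.
move=> ltt; apply/arrowP/orP.
  case=> s lts [/apex_inj-> // [b ->]].
  by case: b; [left | right].
by case=> /eqP->; exists t => //; split=> //; [exists true | exists false].
Qed.

(** The paths, without their origin, from the end c of the t-th transversal edge
    to the end e of the edge {0, 1}, which are the two sinks 0 and 1. *)
Fixpoint fan_paths (e : bool) (t : nat) (c : bool) : seq (seq nat) :=
  if t is t'.+1 then
    if c == base_up m a t' then
      map (cons (fan_end true t')) (fan_paths e t' true) ++
      map (cons (fan_end false t')) (fan_paths e t' false)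
    else fan_paths e t' c
  else if c == e then [:: [::]] else [::].

Lemma neq_base_up t c : c != base_up m a t -> c = ~~ base_up m a t.
Proof. by case: c; case: base_up. Qed.

Lemma fan_end_neq t : t <= N -> fan_end true t <> fan_end false t.
Proof. by move=> le_t /label_inj[]; rewrite ?pos_leN. Qed.

Lemma mem_map_cons (T : eqType) (x z : T) p s :
  (z :: p \in map (cons x) s) = (z == x) && (p \in s).
Proof.
apply/mapP/andP => [[r r_s [-> ->]]|[/eqP-> p_s]]; last by exists p.
by rewrite eqxx.
Qed.

Lemma nil_map_cons (T : eqType) (x : T) s : ([::] \in map (cons x) s) = false.
Proof. by apply/mapP=> -[]. Qed.

Lemma mem_fan_paths e t c p : t <= N ->
  (p \in fan_paths e t c) = fan_path m a (fan_end c t) (fan_end e 0) p.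
Proof.
elim: t c p => [|t IHt] c p le_t.
  rewrite /=; case: p => [|z p]; rewrite /fan_path /=.
    case: eqP => [->|nce]; first by rewrite eqxx.
    by apply/esym/eqP => /label_inj[]; rewrite ?pos0.
  rewrite (_ : arrow _ _ _ _ = false) /=; first by case: ifP.
  by apply/arrowP => -[s lts [Es _]]; case: (@apex_neq s 0 c).
rewrite /=; case: eqVneq => [->|/neq_base_up->]; last first.
  by rewrite IHt 1?ltnW // fan_end_stay.
rewrite mem_cat -/(apex t) /fan_path; case: p => [|z p].
  rewrite !nil_map_cons /=; apply/esym/eqP; exact: apex_neq.
rewrite !mem_map_cons /= arrow_apex // !IHt 1?ltnW // /fan_path.
have neq := fan_end_neq (ltnW le_t).
case: eqP => [->|_] /=; last by case: eqP => //= ->.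
by rewrite (introF eqP neq) orbF.
Qed.

Lemma uniq_fan_paths e t c : t <= N -> uniq (fan_paths e t c).
Proof.
elim: t c => [|t IHt] c le_t /=; first by case: ifP.
case: ifP => _; last by rewrite IHt // ltnW.
rewrite cat_uniq !map_inj_uniq ?IHt 1?ltnW //; try by move=> ? ? [].
rewrite andbT /=; apply/hasPn => p /mapP[r _ ->].
by rewrite mem_map_cons (introF eqP) // => /esym; apply/fan_end_neq/ltnW.
Qed.

(** Oriented paths never go back to the right. *)
Lemma apex_notin e t c p s : p \in fan_paths e t c -> t <= s -> s < N ->
  apex s \notin fan_end c t :: p.
Proof.
move=> + + ltsN; elim: t c p => [|t IHt] c p /=.
  case: eqP => // _; rewrite inE => /eqP-> _; rewrite mem_seq1.
  by apply/eqP/apex_neq.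
case: eqVneq => [->|/neq_base_up->] + lt_ts; last first.
  rewrite fan_end_stay ?(leq_trans lt_ts) 1?ltnW // => /IHt-> //.
  exact: ltnW.
rewrite inE negb_or (introN eqP (apex_neq ltsN lt_ts)) /=.
by rewrite mem_cat => /orP[] /mapP[r /IHt IH ->]; apply: IH; apply: ltnW.
Qed.

(** The side of the strip on which a path from the end c of the t-th transversal
    edge passes above or below triangle s: it is changed by each transversal
    edge used to the right of s. *)
Definition side (c : bool) (t : nat) (p : seq nat) (s : nat) : bool :=
  c (+) odd (count (fun r => diag m a r \in zip (fan_end c t :: p) p)
                   (iota s (t - s))).

Lemma mem_zip_l (S T : eqType) (s : seq S) (r : seq T) x y :
  (x, y) \in zip s r -> x \in s.
Proof.
elim: s r => [|x' s IHs] [|y' r] //=; rewrite !inE => /orP[/eqP[-> _]|/IHs->].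
  by rewrite eqxx.
by rewrite orbT.
Qed.

Lemma diag_notin_zip e t c p s : p \in fan_paths e t c -> t <= s -> s < N ->
  diag m a s \notin zip (fan_end c t :: p) p.
Proof.
move=> p_paths le_ts ltsN; rewrite diagE //.
by apply: contra (apex_notin p_paths le_ts ltsN); apply: mem_zip_l.
Qed.

Lemma iota_rcons s n : iota s n.+1 = rcons (iota s n) (s + n).
Proof. by rewrite -addn1 iotaD cats1. Qed.

Lemma iota_subSn s t : s <= t -> iota s (t.+1 - s) = rcons (iota s (t - s)) t.
Proof. by move=> le_st; rewrite subSn // iota_rcons subnKC. Qed.

Lemma side_stay e t c p s :
    t < N -> c != base_up m a t -> p \in fan_paths e t c -> s <= t ->
  side c t.+1 p s = side c t p s.
Proof.
move=> ltt /neq_base_up-> p_paths le_st; rewrite /side fan_end_stay //.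
rewrite iota_subSn //.
by rewrite -cats1 count_cat /= (negPf (diag_notin_zip p_paths _ _)) // !addn0.
Qed.

Lemma side_move e t c p s :
    t < N -> p \in fan_paths e t c -> s <= t ->
  side (base_up m a t) t.+1 (fan_end c t :: p) s = side c t p s.
Proof.
move=> ltt p_paths le_st; rewrite /side -/(apex t) iota_subSn //.
rewrite -cats1 count_cat.
(* The first edge leaves the apex of t, hence is the transversal edge of no
   triangle but t. *)
have -> : count (fun r => diag m a r \in zip (apex t :: fan_end c t :: p)
                                             (fan_end c t :: p)) (iota s (t - s))
        = count (fun r => diag m a r \in zip (fan_end c t :: p) p)
                (iota s (t - s)).
  apply: eq_in_count => r; rewrite mem_iota subnKC // => /andP[_ ltrt].
  have ltrN := ltn_trans ltrt ltt; rewrite /= inE diagE //.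
  by case: eqP => // -[/apex_inj Ert _]; rewrite Ert // ltnn in ltrt.
rewrite /= inE (negPf (diag_notin_zip p_paths _ _)) // orbF addn0.
rewrite diagE // xpair_eqE eqxx /=.
have ->: (fan_end (~~ base_up m a t) t == fan_end c t) = (c != base_up m a t).
  have neq := fan_end_neq (ltnW ltt).
  case: c {p_paths}; case: base_up; rewrite ?eqxx //=; apply/eqP => //.
  by move/esym.
by rewrite oddD; case: c {p_paths}; case: base_up; case: odd.
Qed.

(** To the left of all arrows the path is at its target. *)
Lemma side0 e t c p : t <= N -> p \in fan_paths e t c -> side c t p 0 = e.
Proof.
elim: t c p => [|t IHt] c p ltt /=.
  by case: eqP => // -> _; rewrite /side /= addbF.
case: eqVneq => [->|ne_c] p_paths; last first.
  by rewrite (side_stay _ _ p_paths) // IHt // ltnW.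
by move: p_paths; rewrite mem_cat => /orP[] /mapP[r r_paths ->];
  rewrite (side_move _ r_paths) // IHt // ltnW.
Qed.

(** Unlike the coarea, the area takes the leftmost triangle into account. *)
Definition area (c : bool) (t : nat) (p : seq nat) : nat :=
  count (side c t p) (iota 0 t).

Lemma area_stay e t c p :
    t < N -> c != base_up m a t -> p \in fan_paths e t c ->
  area c t.+1 p = c + area c t p.
Proof.
move=> ltt ne_c p_paths; rewrite /area iota_rcons add0n -cats1 count_cat addnC.
congr (_ + _); last first.
  apply: eq_in_count => s; rewrite mem_iota add0n => /ltnW.
  exact: (side_stay _ _ p_paths).
by rewrite /= (side_stay _ _ p_paths) // /side subnn addbF addn0.
Qed.

Lemma area_move e t c p :
    t < N -> p \in fan_paths e t c ->
  area (base_up m a t) t.+1 (fan_end c t :: p) = c + area c t p.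
Proof.
move=> ltt p_paths; rewrite /area iota_rcons add0n -cats1 count_cat addnC.
congr (_ + _); last first.
  apply: eq_in_count => s; rewrite mem_iota add0n => /ltnW.
  exact: (side_move _ p_paths).
by rewrite /= (side_move _ p_paths) // /side subnn addbF addn0.
Qed.

Section PathSum.
Local Open Scope ring_scope.
Variables (R : comUnitRingType) (q : R).

(** The exponent -1 for the target 1 cancels the leftmost triangle, which lies
    below all the paths to 1. *)
Definition transfer0 (e : bool) : R * R := if e then (q^-1, 0) else (0, 1).

Lemma sum_fan_paths e t c : q \is a GRing.unit -> (t <= N)%N ->
  let W := foldl (transfer q) (transfer0 e) (take t (fan_word m a)) in
  \sum_(p <- fan_paths e t c) q ^+ area c t p =
    q ^+ e * (if c then W.1 else W.2).
Proof.
move=> q_unit; elim: t c => [|t IHt] c ltt /=.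
  rewrite take0 /=; case: e; case: c; rewrite /= ?big_nil ?mulr0 //.
    by rewrite big_seq1 expr0 expr1 mulrV.
  by rewrite big_seq1 expr0 mul1r.
rewrite (take_nth false) ?size_fan_word // foldl_rcons -/(base_up m a t).
have {}IHt c := IHt c (ltnW ltt).
move: (foldl _ _ _) IHt => -[T F] /= IHt.
case: eqVneq => [->|ne_c].
  rewrite big_cat !big_map /=.
  under eq_big_seq => p p_paths do rewrite (area_move _ p_paths) // exprD expr1.
  rewrite -mulr_sumr IHt.
  under eq_big_seq => p p_paths do rewrite (area_move _ p_paths) // add0n.
  by rewrite IHt /transfer; case: base_up => /=; ring.
under eq_big_seq => p p_paths do rewrite (area_stay _ _ p_paths) // exprD.
rewrite -mulr_sumr IHt /transfer; case: c base_up ne_c => -[] //= _; ring.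
Qed.

End PathSum.

End FanGeometry.

(** * Coarea of the paths *)

(** Replaces the finite type of bounded sequences by an explicit list. *)
Lemma sum_bseq (R : nmodType) n (s : seq (seq nat)) (P : pred (seq nat))
    (F : seq nat -> R) :
    uniq s -> s =i P ->
    (forall p, P p -> (size p <= n) && all (fun v => v < n) p) ->
  (\sum_(p : n.-bseq 'I_n | P (map val p)) F (map val p) = \sum_(p <- s) F p)%R.
Proof.
move=> uniq_s mem_s small_P.
rewrite -big_filter -(big_map (fun p : n.-bseq 'I_n => map val p) predT F).
apply: perm_big; apply: uniq_perm => // [|p].
  rewrite map_inj_uniq ?filter_uniq ?index_enum_uniq //.
  by move=> p r /(inj_map val_inj)/val_inj.
rewrite mem_s; apply/mapP/idP => [[r]|Pp].
  by rewrite mem_filter => /andP[Pr _] ->.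
have /andP[size_p lt_p] := small_P p Pp.
have val_p : map val (pmap insub p : seq 'I_n) = p.
  rewrite pmap_filter; last exact: insubK.
  rewrite (eq_filter (a2 := fun v => v < n)) => [|v]; last exact: isSome_insub.
  exact/all_filterP.
have size_r : size (pmap insub p : seq 'I_n) <= n.
  by rewrite -(size_map val) val_p.
exists (Bseq size_r); last by rewrite /= val_p.
by rewrite mem_filter /= val_p mem_index_enum andbT.
Qed.

Section Coarea.
Variables (m : nat) (a : nat -> nat).
Hypothesis m_gt0 : 0 < m.
Hypothesis a_gt0 : forall i : nat, 1 <= i <= m.*2 -> 0 < a i.
Let N := fan_ntri m a.

Lemma ksum_gt0 : 0 < ksum m a.
Proof.
case: m m_gt0 a_gt0 => // n _ a_pos.
by rewrite ksumS addn_gt0 orbC a_pos // -doubleS !leqnn.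
Qed.

Lemma lsum_gt0 : 0 < lsum m a.
Proof.
case: m m_gt0 a_gt0 => // n _ a_pos.
by rewrite /lsum big_nat_recl //= addn_gt0 a_pos.
Qed.

Lemma fan_word_last : exists w, fan_word m a = rcons w true.
Proof.
case: m m_gt0 a_gt0 => // n _ a_pos; rewrite fan_wordS.
have: 0 < a n.*2.+2 by rewrite a_pos // doubleS !leqnn.
case: (a _) => // b _.
exists (fan_word n a ++ nseq (a n.*2.+1) false ++ nseq b true).
by rewrite -[b.+1]addn1 nseqD !catA cats1.
Qed.

Lemma base_up_last : base_up m a N.-1.
Proof.
have [w Ew] := fan_word_last.
by rewrite /base_up /N -size_fan_word Ew size_rcons /= nth_rcons ltnn eqxx.
Qed.

Lemma fan_end_last : fan_end m a true N = (ksum m a).+1.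
Proof. by rewrite /fan_end posN. Qed.

Lemma zip_bottom_path x y :
  (x, y) \in zip ((ksum m a).+1 :: bottom_path m a) (bottom_path m a) ->
  exists2 i, i <= lsum m a & x = (ksum m a).+1 + i /\
    y = if i < lsum m a then (ksum m a).+2 + i else 1.
Proof.
case/(nthP (0, 0)) => i; rewrite nth_zip_cond => lti; rewrite lti.
move: lti; rewrite size_zip /bottom_path /= size_rcons size_iota => lti [<- <-].
have le_i : i <= lsum m a by lia.
exists i => //.
rewrite -rcons_cons -[_ :: iota _ _]/(iota (ksum m a).+1 (lsum m a).+1).
rewrite !nth_rcons !size_iota ltnS le_i nth_iota //; split=> //.
case: ltnP => lt_i; first by rewrite nth_iota.
by rewrite ifT // eqn_leq le_i.
Qed.

(** The path beta uses two transversal edges, {k+1, k+2} and {n-1, 1}; the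
    latter is the right side of the leftmost triangle. *)
Lemma diag_bottom_path s : 1 <= s < N ->
  (diag m a s \in zip ((ksum m a).+1 :: bottom_path m a) (bottom_path m a))
    = (s == N.-1).
Proof.
case/andP=> s_gt0 ltsN; have l_gt0 := lsum_gt0.
(* A transversal edge is determined by the positions of its ends, which add up
   to its rank. *)
have Es := posE true (ltnW ltsN).
rewrite diagE //; apply/idP/eqP => [|->].
  case/zip_bottom_path => i le_i []; rewrite apexE //.
  have := pos_leN (base_up m a s) ltsN.
  have := pos_leN (~~ base_up m a s) (ltnW ltsN).
  rewrite pos_apex // !posN /fan_end /label /top /bot /fan_n /N /fan_ntri.
  move: Es.
  case: base_up => /=; rewrite -?/(downs m a s).
    case Ed: (downs m a s) => [|d]; case: ifP; lia.
  case: ifP; lia.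
have E_last : N.-1.+1 = N by rewrite prednK // (leq_ltn_trans _ ltsN).
have lt_last : N.-1 < N by rewrite E_last.
rewrite -(fan_end_stay lt_last) /apex base_up_last E_last fan_end_last.
rewrite /fan_end posN /bottom_path /=.
rewrite /bot /fan_n; case: lsum l_gt0 => // l _.
by rewrite /= inE; apply/orP; left; apply/eqP; congr (_, _); lia.
Qed.

Lemma crossings_bottom_path t : 1 <= t < N ->
  crossings m a (ksum m a).+1 (bottom_path m a) t = 1.
Proof.
case/andP=> t_gt0 lttN; rewrite /crossings -/N.
rewrite (eq_in_count (a2 := pred1 N.-1)) => [|s].
  by rewrite -/(count_mem _ _) count_uniq_mem ?iota_uniq // mem_iota; lia.
rewrite mem_iota (subnKC (ltnW lttN)) => /andP[le_ts ltsN].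
by rewrite diag_bottom_path // ltsN (leq_trans t_gt0).
Qed.

(** The single crossing of beta turns an even number of crossings, for which the
    path is still at the top, into an odd total. *)
Lemma enclosed_side p t : 1 <= t < N -> enclosed m a p t = side m a true N p t.
Proof.
move=> t_in; rewrite /enclosed crossings_bottom_path // addn1 oddS.
by rewrite /side fan_end_last.
Qed.

(** The difference is the leftmost triangle, passed on the side of the target. *)
Lemma area_coar e p :
  p \in fan_paths m a e N true -> area m a true N p = e + coar m a p.
Proof.
move=> p_paths; have E_last : N = N.-1.+1.
  by rewrite prednK // /N /fan_ntri addn_gt0 ksum_gt0.
rewrite /area {2}E_last -[iota _ _]cat1s count_cat.
rewrite -[in RHS](side0 (leqnn N) p_paths).
congr (_ + _); first exact: addn0.
apply: eq_in_count => t; rewrite mem_iota add1n -E_last => t_in.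
by rewrite enclosed_side.
Qed.

Lemma path_sum_transfer (R : comUnitRingType) (q : R) e :
    q \is a GRing.unit ->
  path_sum q m a (fan_end m a e 0) =
    (foldl (transfer q) (transfer0 q e) (fan_word m a)).1.
Proof.
move=> q_unit; rewrite /path_sum.
rewrite (@sum_bseq _ _ (fan_paths m a e N true) (fan_path m a _ _)
                   (fun p => q ^+ coar m a p)%R).
- have := sum_fan_paths e true q_unit (leqnn N).
  rewrite /= take_oversize ?size_fan_word //.
  under eq_big_seq => p p_paths do rewrite (area_coar p_paths) exprD.
  by rewrite -mulr_sumr; apply/mulrI/unitrX.
- exact: uniq_fan_paths.
- by move=> p; rewrite mem_fan_paths // fan_end_last.
- by move=> p /fan_path_bounded[/ltnW-> ->].
Qed.

End Coarea.

(** * The numbers of triangles at the top vertices *)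

Section TriangleCount.
Variables (m : nat) (a : nat -> nat).
Let N := fan_ntri m a.

Definition incident (i t : nat) : nat :=
  count (fun r => i \in triangle m a r) (iota 0 t).

Lemma incidentS i t : incident i t.+1 = incident i t + (i \in triangle m a t).
Proof. by rewrite /incident iota_rcons -cats1 count_cat /= addn0. Qed.

Lemma mem_triangle u t : u <= ksum m a -> t < N ->
  (u.+1 \in triangle m a t) = (u == ups m a t) || (u == ups m a t.+1).
Proof.
move=> le_u ltt; have := downs_le m a t.+1; rewrite upsS // downsS //.
have Dbot d : d <= lsum m a -> (u.+1 == bot m a d) = false.
  by rewrite /bot /fan_n; case: d => // d led; lia.
rewrite /triangle; case: base_up => led; rewrite !inE !eqSS !Dbot; lia.
Qed.

Lemma incident_eq0 u t : u <= ksum m a -> t <= N -> ups m a t < u ->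
  incident u.+1 t = 0.
Proof.
move=> le_u; elim: t => // t IHt ltt; rewrite incidentS mem_triangle //.
have := upsS ltt => upsSt lt_u; rewrite IHt ?(ltnW ltt) //; lia.
Qed.

Lemma fan_counts_incident t : t <= N ->
  fan_counts (take t (fan_word m a)) =
    ([seq incident i t | i <- iota 1 (ups m a t)], incident (ups m a t).+1 t).
Proof.
elim: t => [|t IHt] ltt; first by rewrite /ups take0.
rewrite (take_nth false) ?size_fan_word // fan_counts_rcons IHt 1?ltnW //.
have old : [seq incident i t.+1 | i <- iota 1 (ups m a t)]
         = [seq incident i t | i <- iota 1 (ups m a t)].
  apply/eq_in_map => -[|u]; rewrite mem_iota // add1n ltnS => /= lt_u.
  have := ups_le m a t => le_k.
  by rewrite incidentS mem_triangle ?upsS //; lia.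
have last_old : incident (ups m a t).+1 t.+1 = (incident (ups m a t).+1 t).+1.
  by rewrite incidentS mem_triangle ?ups_le // eqxx addn1.
have := upsS ltt; rewrite -/(base_up m a t); case: base_up => /= Eu.
  have Eu1 : ups m a t.+1 = (ups m a t).+1 by rewrite Eu addn1.
  rewrite Eu1 iota_rcons map_rcons add1n old last_old.
  congr (_, _); rewrite incidentS mem_triangle -?Eu1 ?ups_le // eqxx orbT.
  by rewrite incident_eq0 ?ups_le ?(ltnW ltt) ?Eu1.
by rewrite Eu addn0 old last_old.
Qed.

Lemma fan_c_counts : (fan_counts (fan_word m a)).1 = fan_c m a.
Proof.
have := fan_counts_incident (leqnn N).
rewrite take_oversize ?size_fan_word // => -> /=.
by rewrite -/(pos m a true N) posN.
Qed.

End TriangleCount.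

Theorem proposition3p3 (R : comUnitRingType) (q : R) (m : nat) (a : nat -> nat)
    (q_unit : q \is a GRing.unit) (m_gt0 : 0 < m)
    (a_gt0 : forall i : nat, 1 <= i <= m.*2 -> 0 < a i) :
  [/\ contK_even q m a = contE q (fan_c m a),
      contE q (fan_c m a) = path_sum q m a 1,
      contK_odd q m a = contE q (behead (fan_c m a))
    & contE q (behead (fan_c m a)) = path_sum q m a 0].
Proof.
have k_gt0 := ksum_gt0 m_gt0 a_gt0.
have [w Ew] := fan_word_last m_gt0 a_gt0.
have Eeven : contE q (fan_c m a)
    = (foldl (transfer q) (transfer0 q true) (fan_word m a)).1.
  have := contE_transfer (fan_word m a) q_unit.
  rewrite -fan_c_counts Ew fan_counts_rcons.
  by case: fan_counts => s c /= -[_]; rewrite expr1 => /(mulrI q_unit)->.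
have Eodd : contE q (behead (fan_c m a))
    = (foldl (transfer q) (transfer0 q false) (fan_word m a)).1.
  have := contE_behead_transfer q (fan_word m a).
  rewrite -fan_c_counts Ew fan_counts_rcons.
  by case: fan_counts => -[|c1 s] c /= -[_]; rewrite expr1 => /(mulrI q_unit)->.
split.
- by rewrite contK_even_transfer // Eeven.
- by rewrite Eeven -(path_sum_transfer m_gt0 a_gt0 true q_unit) /fan_end pos0.
- by rewrite contK_odd_transfer // Eodd.
- by rewrite Eodd -(path_sum_transfer m_gt0 a_gt0 false q_unit) /fan_end pos0.
Qed.
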